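(* Let $f:\mathbb{R}^n\to[0,1]$ and $g:\mathbb{R}^m\to[0,1]$ be smooth, and let $U=\begin{pmatrix}u_{0,0}&u_{0,1}\\ u_{1,0}&u_{1,1}\end{pmatrix}$ be a real matrix with $v:=u_{0,0}-u_{0,1}-u_{1,0}+u_{1,1}\neq0$, $q:=-\frac{u_{0,1}-u_{1,1}}{v}\in(0,1)$ and $p:=-\frac{u_{1,0}-u_{1,1}}{v}\in(0,1)$. Consider the system $$\dot{\theta}=-v\,\nabla f(\theta)\,(g(\phi)-q),\qquad \dot{\phi}=v\,\nabla g(\phi)\,(f(\theta)-p).$$ If $(\theta(0),\phi(0))\in\mathbb{R}^n\times\mathbb{R}^m$ is a safe initial condition, then the orbit $(\theta(t),\phi(t))$ of this system starting at $(\theta(0),\phi(0))$ is periodic.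
   Context: The system is continuous-time gradient-descent-ascent for $r(\theta,\phi)=F(\theta)^\top U G(\phi)$ with $F(\theta)=(f(\theta),1-f(\theta))^\top$, $G(\phi)=(g(\phi),1-g(\phi))^\top$; $(p,q)$ is the unique mixed Nash equilibrium of the hidden bilinear game $U$. Gradient ascent dynamics of $f$ from $\theta(0)$: let $\gamma:\mathbb{R}\to\mathbb{R}^n$ be the solution of $\dot\gamma=\nabla f(\gamma)$, $\gamma(0)=\theta(0)$, and define $f_{\theta(0)}=\{f(\gamma(s)):s\in\mathbb{R}\}$. $g_{\phi(0)}$ is defined in the same way from $g$ and $\phi(0)$. The initial condition $(\theta(0),\phi(0))$ is called safe if $\theta(0)$ is not a stationary point of $f$, $\phi(0)$ is not a stationary point of $g$, $p\in f_{\theta(0)}$ and $q\in g_{\phi(0)}$. A constant orbit (fixed point) counts as periodic. *)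

(* Defs.v *)
From HB Require Import structures.
From mathcomp Require Import all_boot all_order all_algebra.
From mathcomp Require Import all_classical all_reals all_analysis.
Set Implicit Arguments.
Unset Strict Implicit.
Unset Printing Implicit Defensive.
Import Order.TTheory GRing.Theory Num.Theory.
Import numFieldNormedType.Exports.
Local Open Scope classical_set_scope.
Local Open Scope ring_scope.

Definition partial (R : realType) (n : nat) (i : 'I_n) (f : 'rV[R]_n -> R)
  (x : 'rV[R]_n) : R := 'D_(delta_mx 0 i) f x.

Definition grad (R : realType) (n : nat) (f : 'rV[R]_n -> R) (x : 'rV[R]_n) :
  'rV[R]_n := \row_i partial i f x.

(* [differentiable] is Frechet differentiability; a function is of class
   C^(k+1) iff it is differentiable everywhere with C^k partial derivatives. *)
Fixpoint Ck (R : realType) (n k : nat) (f : 'rV[R]_n -> R) : Prop :=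
  match k with
  | 0 => continuous f
  | k'.+1 => (forall x, differentiable f x) /\ forall i, Ck k' (partial i f)
  end.

Definition smooth (R : realType) (n : nat) (f : 'rV[R]_n -> R) : Prop :=
  forall k, Ck k f.

Definition stationary (R : realType) (n : nat) (f : 'rV[R]_n -> R)
  (x : 'rV[R]_n) : Prop := grad f x = 0.

Definition gradient_ascent (R : realType) (n : nat) (f : 'rV[R]_n -> R)
    (x0 : 'rV[R]_n) : set (R -> 'rV[R]_n) :=
  [set gamma | gamma 0 = x0 /\
    forall s : R, is_derive s 1 gamma (grad f (gamma s))].

(* For smooth bounded f the set [gradient_ascent f x0] is a singleton, so the
   union is the range of f along the gradient ascent curve through x0. *)
Definition ascent_values (R : realType) (n : nat) (f : 'rV[R]_n -> R)
    (x0 : 'rV[R]_n) : set R :=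
  \bigcup_(gamma in gradient_ascent f x0) range (f \o gamma).

(* (game_p U, game_q U) is the mixed equilibrium of the zero-sum bilinear game
   (x, 1 - x)^T U (y, 1 - y) when game_v U != 0 and both values lie in ]0, 1[. *)
Definition game_v (R : realType) (U : 'M[R]_2) : R :=
  U 0 0 - U 0 1 - U 1 0 + U 1 1.

Definition game_q (R : realType) (U : 'M[R]_2) : R :=
  - ((U 0 1 - U 1 1) / game_v U).

Definition game_p (R : realType) (U : 'M[R]_2) : R :=
  - ((U 1 0 - U 1 1) / game_v U).

Definition safe (R : realType) (n m : nat) (f : 'rV[R]_n -> R)
    (g : 'rV[R]_m -> R) (U : 'M[R]_2) (theta0 : 'rV[R]_n)
    (phi0 : 'rV[R]_m) : Prop :=
  [/\ ~ stationary f theta0, ~ stationary g phi0,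
      ascent_values f theta0 (game_p U) & ascent_values g phi0 (game_q U)].

(* For r(theta, phi) = (f, 1 - f)^T U (g, 1 - g) one has
   grad_theta r = v (g - q) grad f and grad_phi r = v (f - p) grad g, so this
   is gradient descent in theta and gradient ascent in phi. *)
Definition gda_orbit (R : realType) (n m : nat) (f : 'rV[R]_n -> R)
    (g : 'rV[R]_m -> R) (U : 'M[R]_2) (theta0 : 'rV[R]_n) (phi0 : 'rV[R]_m)
    (theta : R -> 'rV[R]_n) (phi : R -> 'rV[R]_m) : Prop :=
  [/\ theta 0 = theta0, phi 0 = phi0,
      forall t : R, is_derive t 1 theta
        (- (game_v U * (g (phi t) - game_q U)) *: grad f (theta t)) &
      forall t : R, is_derive t 1 phi
        ((game_v U * (f (theta t) - game_p U)) *: grad g (phi t))].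

(* Any positive common period is allowed, so constant orbits are periodic. *)
Definition periodic_orbit (R : realType) (n m : nat)
    (theta : R -> 'rV[R]_n) (phi : R -> 'rV[R]_m) : Prop :=
  exists T : R, [/\ 0 < T, periodic theta T & periodic phi T].

(* Main.v *)
Require Import Defs.
From mathcomp Require Import all_boot all_order all_algebra.
From mathcomp Require Import all_classical all_reals all_analysis.
From mathcomp Require Import ring lra.
Import Order.TTheory GRing.Theory Num.Theory.
Import numFieldNormedType.Exports.
Set Implicit Arguments.
Unset Strict Implicit.
Unset Printing Implicit Defensive.
Local Open Scope classical_set_scope.
Local Open Scope ring_scope.

(** Along the flow theta only moves forwards and backwards on the gradient
    ascent curve X of f through theta0, and phi on the gradient ascent curve Y
    of g through phi0.  Writing theta = X(a) and phi = Y(b), parametrised so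
    that f(X(0)) = p and g(Y(0)) = q, which is possible as safety puts p and q
    among the values of f and g on these curves, the system becomes planar:
      a' = - v l(b),   b' = v k(a),   k = f o X - p,   l = g o Y - q.
    The derivative of k is |grad f|^2 along X, which never vanishes: if it did,
    uniqueness of solutions would make X constant and theta0 stationary
    ([ascent_profile]).  So k and l are increasing and vanish at 0.

    The planar system preserves P(a) + Q(b), where P and Q are the primitives
    of k and l vanishing at 0; both are strictly convex with a nondegenerate
    minimum, and the level sets are closed curves around the origin.  In the
    coordinates x, y with P = x^2/2 and Q = y^2/2 they are circles.  The
    inverse changes of variables a = A(x) and b = B(y) are C^1 with positive
    derivatives, and k(A(x)) A'(x) = x ([square_root_coordinate]).  Hence
    x = r cos psi, y = r sin psi solves the system as soon as
      psi' = v / (A'(r cos psi) B'(r sin psi)).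
    The right-hand side is 2 pi-periodic in psi, of constant sign and bounded
    away from 0 and infinity, so this scalar equation is solved by inverting
    the time function, and psi makes one full turn in a fixed time
    ([rotation_clock], [planar_center]).  This gives a global periodic orbit.

    By smoothness the full vector field is Lipschitz on boxes, so the Gronwall
    argument of [ode_unique] shows that every orbit with the same initial
    condition is this periodic one ([gda_orbit_unique]). *)

(** * Calculus on the real line *)

Section RealLine.
Context {R : realType}.
Implicit Types (f df k : R -> R).

Lemma derive_continuous f df :
  (forall x : R, is_derive x 1 f (df x)) -> continuous f.
Proof.
move=> fD x; apply/differentiable_continuous/derivable1_diffP.
by have [] := fD x.
Qed.

Lemma mean_value f df a b : a <= b -> (forall x : R, is_derive x 1 f (df x)) ->
  exists2 c, a <= c <= b & f b - f a = df c * (b - a).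
Proof.
move=> ab fD.
have fC : {within `[a, b], continuous f}.
  by apply: continuous_subspaceT; exact: (derive_continuous fD).
have [c] := MVT_segment ab (fun x _ => fD x) fC.
by rewrite in_itv/=; exists c.
Qed.

Lemma derive_gt0_increasing f df :
    (forall x : R, is_derive x 1 f (df x)) -> (forall x, 0 < df x) ->
  {mono f : x y / x <= y}.
Proof.
move=> fD df_gt0; apply: le_mono => x y xy; rewrite -subr_gt0.
have [c _ ->] := mean_value (ltW xy) fD.
by rewrite mulr_gt0// subr_gt0.
Qed.

(** The integral of k from - M is a primitive on the half-line right of - M
    only, so the primitive at x is computed with a base point depending on x;
    normalising at 0 makes the choices of base point agree. *)
Lemma continuous_antiderivative k : continuous k ->
  exists P : R -> R, P 0 = 0 /\ forall x : R, is_derive x 1 P (k x).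
Proof.
move=> kC.
pose mu := @lebesgue_measure R.
pose F M x := Rintegral mu `[- M, x]%classic k.
have FD (M x : R) : - M < x -> is_derive x 1 (F M) (k x).
  move=> Mx.
  have [||FD Fk] :=
    @continuous_FTC1_closed R k (- M) x (x + 1) _ _ Mx (kC x).
  - by rewrite ltrDl.
  - apply: continuous_compact_integrable; first exact: segment_compact.
    exact: continuous_subspaceT.
  by apply: DeriveDef => //; rewrite -derive1E.
pose P x := F (`|x| + 1) x - F (`|x| + 1) 0.
have FP (M x : R) : 0 < M -> - M < x -> P x = F M x - F M 0.
  move=> M_gt0 Mx; rewrite /P; set N := `|x| + 1.
  have N_gt0 : 0 < N by rewrite ltr_wpDl.
  have Nx : - N < x by rewrite /N; have := ler_norm (- x); rewrite normrN; lra.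
  apply/eqP; rewrite -subr_eq0.
  pose G y := F N y - F M y.
  suff: G x - G 0 = 0.
    by move=> Gx; rewrite -[X in _ == X]Gx /G; apply/eqP; ring.
  have GD (y : R) : (- N < y) && (- M < y) -> is_derive y 1 G 0.
    move=> /andP[Ny My]; have := is_deriveB (FD _ _ Ny) (FD _ _ My).
    by rewrite subrr.
  have G0 : forall a b, - N < a -> - M < a -> a <= b -> G b - G a = 0.
    move=> a b Na Ma ab.
    have GDab y : a <= y -> is_derive y 1 G 0.
      by move=> ay; apply: GD; rewrite (lt_le_trans Na ay) (lt_le_trans Ma ay).
    have GC : {within `[a, b], continuous G}.
      apply: derivable_within_continuous => y.
      by rewrite in_itv/= => /andP[/GDab[]].
    have GDoo y : y \in `]a, b[%R -> is_derive y 1 G 0.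
      by rewrite in_itv/= => /andP[/ltW/GDab].
    by have [c _ ->] := MVT_segment ab GDoo GC; rewrite mul0r.
  have [x0|/ltW x0] := leP 0 x.
    by apply: G0 => //; rewrite oppr_lt0.
  by apply/eqP; rewrite -oppr_eq0 opprB; apply/eqP/G0.
exists P; split; first by rewrite /P subrr.
move=> x.
have M0 : 0 < `|x| + 1 by rewrite ltr_wpDl.
have xM : - (`|x| + 1) < x by have := ler_norm (- x); rewrite normrN; lra.
have PD : is_derive x 1 (fun y => F (`|x| + 1) y - F (`|x| + 1) 0) (k x).
  have := is_deriveB (FD _ _ xM) (is_derive_cst (F (`|x| + 1) 0) x 1).
  by rewrite subr0.
apply: near_eq_is_derive PD.
near=> y; apply/esym/FP => //.
near: y; exact: lt_nbhsr.
Unshelve. all: by end_near. Qed.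

Lemma expanding_surjective f df (m : R) : 0 < m ->
    (forall x : R, is_derive x 1 f (df x)) -> (forall x, m <= df x) ->
  forall y, exists x, f x = y.
Proof.
move=> m_gt0 fD mdf y.
pose z := `|y - f 0| / m.
have z_ge0 : 0 <= z by rewrite divr_ge0// ltW.
have mz : m * z = `|y - f 0| by rewrite mulrC divfK// gt_eqF.
have fz : y <= f z.
  have [c _ fcE] := mean_value z_ge0 fD.
  have : m * z <= df c * z by rewrite ler_wpM2r.
  by rewrite mz; have := ler_norm (y - f 0); lra.
have fNz : f (- z) <= y.
  have [|c _ fcE] := @mean_value f df (- z) 0 _ fD; first by rewrite oppr_le0.
  have : m * z <= df c * z by rewrite ler_wpM2r.
  by rewrite mz; have := ler_norm (f 0 - y); rewrite distrC; lra.
have zz : - z <= z by lra.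
have fC : {within `[- z, z], continuous f}.
  by apply: continuous_subspaceT; exact: (derive_continuous fD).
have yz : Num.min (f (- z)) (f z) <= y <= Num.max (f (- z)) (f z).
  by rewrite ge_min fNz /= le_max fz orbT.
by have [x _ <-] := IVT zz fC yz; exists x.
Qed.

Lemma increasing_inverse f df :
    (forall x : R, is_derive x 1 f (df x)) -> (forall x, 0 < df x) ->
    (forall y, exists x, f x = y) ->
  exists h : R -> R, [/\ cancel f h, cancel h f &
    forall y : R, is_derive y 1 h (df (h y))^-1].
Proof.
move=> fD df_gt0 fS.
pose h y := sval (cid (fS y)).
have hK : cancel h f by move=> y; exact: svalP (cid (fS y)).
have fI : injective f by apply: inc_inj; exact: derive_gt0_increasing df_gt0.
have fK : cancel f h by move=> x; apply: fI; rewrite hK.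
exists h; split=> // y.
rewrite -{1}(hK y); apply: is_derive_inverse.
- by near=> x; exact: fK.
- by near=> x; exact: derive_continuous fD x.
- by rewrite gt_eqF.
Unshelve. all: by end_near. Qed.

End RealLine.

(** * The square-root coordinate of a convex potential *)

Section SquareRootCoordinate.
Context {R : realType}.
Implicit Types (f h k : R -> R).

(** Away from 0, h is the quotient of f by the identity. *)
Lemma factor_continuous f h : (forall z, f z = h z * z) ->
  continuous f -> {for 0, continuous h} -> continuous h.
Proof.
move=> fE fC h0 z; have [->//|z_neq0] := eqVneq z 0.
have hfE : \forall y \near z, f y / y = h y.
  near=> y; rewrite fE mulfK//; near: y.
  by apply: open_nbhs_nbhs; split; [exact: open_neq|].
have fzC : f y / y @[y --> z] --> h z.
  rewrite -(nbhs_singleton hfE); apply: cvgM; first exact: fC.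
  by apply: cvgV => //; exact: cvg_id.
by apply: cvg_trans fzC; exact: near_eq_cvg.
Unshelve. all: by end_near. Qed.

(** With P the primitive of k vanishing at 0, alpha is the inverse of the
    signed square root X of 2 P, that is P (alpha x) = x^2 / 2; differentiating
    this gives the relation between k, alpha and dalpha.  The delicate point is
    the minimum of P, where the square root is singular: there X is factored as
    K z * z, and K is continuous at 0 with value sqrt c by l'Hospital's rule.
    Convexity of P gives positivity and growth, hence surjectivity of X. *)
Lemma square_root_coordinate k (c : R) :
    continuous k -> {mono k : x y / x <= y} -> k 0 = 0 ->
    is_derive (0 : R) 1 k c -> 0 < c ->
  exists alpha dalpha : R -> R, [/\
    forall x : R, is_derive x 1 alpha (dalpha x), continuous dalpha,
    forall x, 0 < dalpha x, forall x, k (alpha x) * dalpha x = x &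
    forall y, exists x, alpha x = y].
Proof.
move=> kC kmono k0 kD c_gt0.
have [h [hE h0C h0]] := (is_derive1_caratheodory k 0 c).1 kD.
have {}hE z : k z = h z * z by have := hE z; rewrite k0 !subr0.
have [P [P0 PD]] := continuous_antiderivative kC.
have h_gt0 z : 0 < h z.
  have [->|z0] := eqVneq z 0; first by rewrite h0.
  rewrite -(pmulr_lgt0 _ (_ : 0 < z ^+ 2)); last by rewrite exprn_even_gt0.
  rewrite expr2 mulrA -hE; have [z_lt0|z_gt0|] := ltgtP z 0; last first.
  - by move/eqP; rewrite (negbTE z0).
  - by rewrite mulr_gt0// -k0 (leW_mono kmono).
  - by rewrite nmulr_lgt0// -k0 (leW_mono kmono).
have tangent x y : k x * (y - x) <= P y - P x.
  have [xy|/ltW yx] := leP x y.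
    have [w /andP[xw _] ->] := mean_value xy PD.
    by rewrite ler_wpM2r ?subr_ge0// kmono.
  have [w /andP[_ wx] PE] := mean_value yx PD.
  by rewrite -lerN2 -mulrN !opprB PE ler_wpM2r ?subr_ge0// kmono.
have P_gt0 (z : R) : z != 0 -> 0 < P z.
  move=> z0.
  have : 0 < k (z / 2) * (z / 2).
    by rewrite hE -mulrA -expr2 mulr_gt0// exprn_even_gt0//= mulf_neq0.
  have := tangent (z / 2) z; have := tangent 0 (z / 2).
  rewrite P0 k0 mul0r (_ : z - z / 2 = z / 2); last by field.
  lra.
pose K (z : R) := Num.sqrt (if z == 0 then c else 2 * P z / z ^+ 2).
have K_gt0 z : 0 < K z.
  rewrite sqrtr_gt0; case: eqVneq => // z0.
  by rewrite divr_gt0 ?exprn_even_gt0// mulr_gt0 ?P_gt0.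
have K0C : {for 0, continuous K}.
  apply: (@continuous_comp _ _ _
    (fun z => if z == 0 then c else 2 * P z / z ^+ 2) Num.sqrt);
    last exact: sqrt_continuous.
  apply/continuous_withinNx; rewrite eqxx.
  have : 2 * P z / z ^+ 2 @[z --> (0 : R)^'] --> c.
    (* l'Hospital's rule asks for the limit of the quotient of derivatives over
       a full neighbourhood; the value of dsqr at 0 makes this quotient equal
       to h there as well. *)
    pose dsqr (z : R) := if z == 0 then 1 else 2 * z.
    have dsqr_neq0 z : dsqr z != 0.
      rewrite /dsqr; case: (eqVneq z 0) => [_|z0]; first exact: oner_neq0.
      by rewrite mulf_neq0// pnatr_eq0.
    have punctured z : z \in (`]-1, 1[ `\ (0 : R)) -> z != 0.
      by rewrite inE => -[_ /eqP].
    apply: (@lhopital R (fun z => 2 * P z) (fun z => h z * dsqr z)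
      (fun z => z ^+ 2) dsqr (-1) 1 0).
    - by rewrite in_itv/= ltrN10 ltr01.
    - move=> z /punctured z0; rewrite /dsqr (negbTE z0) mulrCA -hE.
      exact: is_deriveZ.
    - move=> z /punctured z0; rewrite /dsqr (negbTE z0).
      by apply: is_derive_eq; rewrite /GRing.scale/=; ring.
    - have P2C : 2 * P z @[z --> (0 : R)] --> 2 * P 0.
        by apply: cvgM; [exact: cvg_cst|exact: (derive_continuous PD)].
      by rewrite P0 mulr0 in P2C.
    - have sqrC : z ^+ 2 @[z --> (0 : R)] --> (0 : R) ^+ 2.
        exact: exprn_continuous.
      by rewrite expr0n in sqrC.
    - by move=> z _; exact: dsqr_neq0.
    - by under eq_fun do rewrite mulfK//; rewrite -h0.
  apply: cvg_trans; apply: near_eq_cvg.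
  near=> z; rewrite ifN//; near: z; exact: nbhs_dnbhs_neq.
pose X (z : R) := K z * z.
have XE (z y : R) : 0 < z * y -> X y = Num.sg z * Num.sqrt (2 * P y).
  move=> zy; have y0 : y != 0 by apply: contraTneq zy => ->; rewrite mulr0 ltxx.
  have -> : Num.sg z = Num.sg y.
    have : Num.sg z * Num.sg y = 1 by rewrite -sgrM gtr0_sg.
    by case: (sgrP z) => _; case: (sgrP y) => _; lra.
  rewrite /X /K (negbTE y0) sqrtrM ?mulr_ge0 ?ltW ?P_gt0//.
  rewrite sqrtrV ?sqr_ge0// sqrtr_sqr.
  have ny : `|y| != 0 by rewrite normr_eq0.
  by rewrite -[X in _ * X = _]mulr_sg_norm; field.
have XD (z : R) : is_derive z 1 X (h z / K z).
  have [->|z0] := eqVneq z 0.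
    apply/is_derive1_caratheodory; exists K; split=> //.
      by move=> y; rewrite /X mulr0 !subr0.
    have K0 : K 0 = Num.sqrt c by rewrite /K eqxx.
    rewrite K0 h0 -{2}(sqr_sqrtr (ltW c_gt0)) expr2 mulfK//.
    by rewrite gt_eqF// sqrtr_gt0.
  have z2 : 0 < z * z by rewrite -expr2 exprn_even_gt0.
  have P2 : 0 < 2 * P z by rewrite mulr_gt0 ?P_gt0.
  apply: (@near_eq_is_derive _ _ _ (fun y => Num.sg z * Num.sqrt (2 * P y))).
    near=> y; apply/esym/XE; near: y.
    apply: (@cvgr_gt _ _ _ _ (fun y => z * y) (z * z)) => //.
    by apply: cvgM; [exact: cvg_cst|exact: cvg_id].
  have := is_deriveZ (Num.sg z)
    (@is_derive1_comp _ _ (fun y => 2 * P y) _ _ _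
      (is_derive1_sqrt P2) (is_deriveZ 2 (PD z))).
  move=> XzD; apply: (is_derive_eq XzD).
  have X0 : X z = Num.sg z * Num.sqrt (2 * P z) by exact: XE.
  have S0 : Num.sqrt (2 * P z) != 0 by rewrite gt_eqF// sqrtr_gt0.
  have -> : h z / K z = k z / X z.
    by rewrite hE /X; field; rewrite z0 gt_eqF.
  have sgV : (Num.sg z)^-1 = Num.sg z.
    by case: (sgrP z) => _; rewrite ?invr0 ?invr1 ?invrN1.
  rewrite X0 [in RHS]invfM sgV /GRing.scale/=; field.
  by rewrite S0.
have KC : continuous K.
  by apply: (@factor_continuous X) => //; exact: (derive_continuous XD).
have hC : continuous h by exact: (@factor_continuous k).
have XS y : exists x, X x = y.
  have far e : e != 0 -> exists2 w, `|y| <= Num.sqrt (2 * P w) &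
      0 < e * w /\ X w = Num.sg e * Num.sqrt (2 * P w).
    (* By the tangent inequality at e this w satisfies P w >= y^2. *)
    move=> e0; exists (e + y ^+ 2 / k e); last first.
      suff ew : 0 < e * (e + y ^+ 2 / k e) by split=> //; exact: XE.
      rewrite mulrDr -expr2 ltr_pwDl ?exprn_even_gt0//.
      have -> : e * (y ^+ 2 / k e) = y ^+ 2 / h e.
        by rewrite hE; field; rewrite e0 gt_eqF.
      by rewrite divr_ge0 ?sqr_ge0// ltW.
    have := tangent e (e + y ^+ 2 / k e).
    rewrite addrAC subrr add0r mulrCA mulfV ?mulr1; last first.
      by rewrite hE mulf_neq0// gt_eqF.
    have := P_gt0 e e0; rewrite -sqrtr_sqr => Pe Pw.
    by apply: ler_wsqrtr; have := sqr_ge0 y; lra.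
  have [w1 yw1 [w1_gt0 w1E]] := far 1 (oner_neq0 _).
  have N1_neq0 : -1 != 0 :> R by rewrite oppr_eq0 oner_neq0.
  have [w2 yw2 [w2_gt0 w2E]] := far (-1) N1_neq0.
  have XC : {within `[w2, w1], continuous X}.
    by apply: continuous_subspaceT; exact: (derive_continuous XD).
  have w21 : w2 <= w1 by lra.
  have /(IVT w21 XC)[x _ <-] :
      Num.min (X w2) (X w1) <= y <= Num.max (X w2) (X w1).
    move: w1E w2E; rewrite sgrN !sgr1 mul1r mulN1r => -> ->.
    rewrite ge_min le_max; apply/andP; split; apply/orP.
      by left; have := ler_norm (- y); rewrite normrN; lra.
    by right; have := ler_norm y; lra.
  by exists x.
have X'_gt0 z : 0 < h z / K z by rewrite divr_gt0.
have [alpha [XK alphaK alphaD]] := increasing_inverse XD X'_gt0 XS.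
exists alpha, (fun y => (h (alpha y) / K (alpha y))^-1); split => //.
- have alphaC := derive_continuous alphaD.
  have haC : continuous (h \o alpha).
    by move=> y; apply: continuous_comp; [exact: alphaC|exact: hC].
  have KaC : continuous (K \o alpha).
    by move=> y; apply: continuous_comp; [exact: alphaC|exact: KC].
  move=> y; apply: cvgV; first by rewrite gt_eqF.
  by apply: cvgM; [exact: haC|apply: cvgV; [rewrite gt_eqF|exact: KaC]].
- by move=> x; rewrite invr_gt0.
- move=> x; rewrite hE -[RHS]alphaK /X; field.
  by rewrite !gt_eqF.
- by move=> y; exists (X y).
Unshelve. all: by end_near. Qed.

End SquareRootCoordinate.

(** * Planar systems rotating around a centre *)

Section PlanarCenter.
Context {R : realType}.
Implicit Types (k l : R -> R).

Lemma polar_coordinates (x y : R) :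
  exists r phi, x = r * cos phi /\ y = r * sin phi.
Proof.
pose r := Num.sqrt (x ^+ 2 + y ^+ 2).
have r2 : r ^+ 2 = x ^+ 2 + y ^+ 2 by rewrite sqr_sqrtr// addr_ge0 ?sqr_ge0.
have [r0|r_neq0] := eqVneq r 0.
  exists 0, 0; rewrite !mul0r; move: r2; rewrite r0 expr0n/= => /esym/eqP.
  by rewrite paddr_eq0 ?sqr_ge0// !sqrf_eq0 => /andP[/eqP-> /eqP->].
have r_gt0 : 0 < r by rewrite lt_neqAle eq_sym r_neq0 sqrtr_ge0.
have xr : -1 <= x / r <= 1.
  rewrite -ler_norml normrM normfV (gtr0_norm r_gt0) ler_pdivrMr// mul1r.
  by rewrite -sqrtr_sqr ler_wsqrtr// lerDl sqr_ge0.
have sE : r * Num.sqrt (1 - (x / r) ^+ 2) = `|y|.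
  rewrite -{1}(gtr0_norm r_gt0) -sqrtr_sqr -sqrtrM ?sqr_ge0//.
  rewrite mulrBr mulr1 -exprMn mulrC divfK// r2 addrAC subrr add0r.
  by rewrite sqrtr_sqr.
have xE : x = r * (x / r) by rewrite mulrC divfK.
have [y_ge0|/ltW y_le0] := leP 0 y.
  exists r, (acos (x / r)).
  by rewrite acosK ?in_itv// sin_acos// sE ger0_norm.
exists r, (- acos (x / r)).
rewrite cosN sinN acosK ?in_itv// sin_acos// mulrN sE ler0_norm//.
by rewrite opprK.
Qed.

Lemma continuous_positive_bound (f : R -> R) (a b : R) : a <= b ->
    continuous f -> (forall x, 0 < f x) ->
  exists2 m, 0 < m & forall x, a <= x <= b -> m <= f x.
Proof.
move=> ab fC f_gt0; have [|c _ cmin] := @EVT_min R f a b ab.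
  exact: continuous_subspaceT.
by exists (f c) => // x xab; apply: cmin; rewrite in_itv.
Qed.

Lemma periodic_opp (V : zmodType) (f : R -> V) (T : R) :
  periodic f T -> periodic f (- T).
Proof. by move=> fT u; rewrite -(fT (u - T)) subrK. Qed.

(** Separation of variables: S (phi t) - S phi0 = c t for a primitive S of w,
    so phi is obtained by inverting S.  By periodicity of w a full turn raises
    S by a constant tau, which takes the time tau / |c|; the sign of c decides
    in which direction the turn is made. *)
Lemma rotation_clock (w : R -> R) (m c phi0 : R) : c != 0 -> 0 < m ->
    continuous w -> (forall x, m <= w x) -> periodic w (pi *+ 2) ->
  exists phi : R -> R, [/\ phi 0 = phi0,
    forall t : R, is_derive t 1 phi (c / w (phi t)) &
    exists2 T, 0 < T & forall t, phi (t + T) = phi t + pi *+ 2 \/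
                                phi (t + T) = phi t - pi *+ 2].
Proof.
move=> c_neq0 m_gt0 wC mw wP.
have w_gt0 x : 0 < w x by exact: lt_le_trans (mw x).
have [S [S0 SD]] := continuous_antiderivative wC.
have [h [SK hK hD]] :=
  increasing_inverse SD w_gt0 (expanding_surjective m_gt0 SD mw).
pose tau := S (pi *+ 2).
have Stau x : S (x + pi *+ 2) = S x + tau.
  pose G (y : R) := S (y + pi *+ 2) - S y.
  have GD (y : R) : is_derive y 1 G 0.
    have SDy := is_derive1_comp (SD (shift (pi *+ 2) y))
      (is_derive_shift y 1 (pi *+ 2)).
    by apply: is_derive_eq (is_deriveB SDy (SD y)) _; rewrite mulr1 wP subrr.
  have : G x = G 0 by exact: is_derive_0_is_cst.
  by rewrite /G add0r S0 subr0 -/tau => <-; rewrite [RHS]addrC subrK.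
have htau s : h (s + tau) = h s + pi *+ 2.
  by rewrite -{1}(hK s) -Stau SK.
have hNtau s : h (s - tau) = h s - pi *+ 2.
  by apply: (addIr (pi *+ 2)); rewrite -htau !subrK.
have tau_gt0 : 0 < tau.
  rewrite -S0 (leW_mono (derive_gt0_increasing SD w_gt0)).
  by rewrite mulrn_wgt0// pi_gt0.
exists (fun t => h (S phi0 + c * t)); split.
- by rewrite mulr0 addr0 SK.
- move=> t; set f := fun t => S phi0 + c * t.
  have fD : is_derive t 1 f (0 + c *: 1).
    exact: is_deriveD (is_derive_cst _ _ _) (is_deriveZ c (is_derive_id t 1)).
  apply: is_derive_eq (is_derive1_comp (hD (f t)) fD) _.
  by rewrite add0r mulrC; congr (_ / _); exact: mulr1.
- exists (tau / `|c|); first by rewrite divr_gt0// normr_gt0.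
  move=> t; have [c_lt0|c_gt0|c0] := ltgtP c 0.
  + right; rewrite -hNtau; congr h; rewrite ltr0_norm//; field.
    exact: ltr0_neq0.
  + left; rewrite -htau; congr h; rewrite gtr0_norm//; field.
    exact: lt0r_neq0.
  + by rewrite c0 eqxx in c_neq0.
Qed.

(** The square-root coordinates of the two potentials turn the level sets of
    the conserved quantity into circles, on which the motion is a rotation with
    variable speed.  An orbit at the origin is the case r = 0. *)
Lemma planar_center k l (ck cl v a0 b0 : R) : v != 0 ->
    continuous k -> {mono k : x y / x <= y} -> k 0 = 0 ->
    is_derive (0 : R) 1 k ck -> 0 < ck ->
    continuous l -> {mono l : x y / x <= y} -> l 0 = 0 ->
    is_derive (0 : R) 1 l cl -> 0 < cl ->
  exists a b : R -> R, [/\ a 0 = a0, b 0 = b0,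
    forall t : R, is_derive t 1 a (- (v * l (b t))),
    forall t : R, is_derive t 1 b (v * k (a t)) &
    exists T, [/\ 0 < T, periodic a T & periodic b T]].
Proof.
move=> v0 kC kM k0 kD ck_gt0 lC lM l0 lD cl_gt0.
have [A [dA [AD dAC dA_gt0 AE AS]]] :=
  square_root_coordinate kC kM k0 kD ck_gt0.
have [B [dB [BD dBC dB_gt0 BE BS]]] :=
  square_root_coordinate lC lM l0 lD cl_gt0.
have [x0 Ax0] := AS a0; have [y0 By0] := BS b0.
have [r [phi0 [x0E y0E]]] := polar_coordinates x0 y0.
pose w phi := dA (r * cos phi) * dB (r * sin phi).
have [|mA mA_gt0 mdA] :=
  @continuous_positive_bound dA (- `|r|) `|r| _ dAC dA_gt0.
  by rewrite ge0_cp.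
have [|mB mB_gt0 mdB] :=
  @continuous_positive_bound dB (- `|r|) `|r| _ dBC dB_gt0.
  by rewrite ge0_cp.
have wC : continuous w.
  move=> phi; apply: cvgM.
    apply: (continuous_comp (f := fun t => r * cos t)); last exact: dAC.
    by apply: cvgM; [exact: cvg_cst|exact: continuous_cos].
  apply: (continuous_comp (f := fun t => r * sin t)); last exact: dBC.
  by apply: cvgM; [exact: cvg_cst|exact: continuous_sin].
have mw phi : mA * mB <= w phi.
  apply: ler_pM; rewrite ?(ltW mA_gt0) ?(ltW mB_gt0)//.
    by apply: mdA; rewrite -ler_norml normrM ler_piMr// cos_max.
  by apply: mdB; rewrite -ler_norml normrM ler_piMr// sin_max.
have wP : periodic w (pi *+ 2) by move=> phi; rewrite /w cosD2pi sinD2pi.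
have [phi [phi0E phiD [T T_gt0 phiT]]] :=
  rotation_clock phi0 v0 (mulr_gt0 mA_gt0 mB_gt0) wC mw wP.
exists (fun t => A (r * cos (phi t))), (fun t => B (r * sin (phi t))); split.
- by rewrite phi0E -x0E.
- by rewrite phi0E -y0E.
- move=> t; have cosD := is_deriveZ r
    (is_derive1_comp (is_derive_cos (phi t)) (phiD t)).
  apply: is_derive_eq
    (@is_derive1_comp _ A (fun t => r * cos (phi t)) t _ _ (AD _) cosD) _.
  have dB_neq0 := lt0r_neq0 (dB_gt0 (r * sin (phi t))).
  rewrite -[X in _ = - (v * X)](mulfK dB_neq0 (l _)) BE /w.
  by rewrite /GRing.scale/=; field; rewrite !gt_eqF.
- move=> t; have sinD := is_deriveZ r
    (is_derive1_comp (is_derive_sin (phi t)) (phiD t)).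
  apply: is_derive_eq
    (@is_derive1_comp _ B (fun t => r * sin (phi t)) t _ _ (BD _) sinD) _.
  have dA_neq0 := lt0r_neq0 (dA_gt0 (r * cos (phi t))).
  rewrite -[X in _ = v * X](mulfK dA_neq0 (k _)) AE /w.
  by rewrite /GRing.scale/=; field; rewrite !gt_eqF.
- have cosT t : cos (phi (t + T)) = cos (phi t).
    have [->|->] := phiT t; first exact: cosD2pi.
    exact: (periodic_opp (@cosD2pi R)).
  have sinT t : sin (phi (t + T)) = sin (phi t).
    have [->|->] := phiT t; first exact: sinD2pi.
    exact: (periodic_opp (@sinD2pi R)).
  by exists T; split=> // t; rewrite /= ?cosT ?sinT.
Qed.

End PlanarCenter.

(** * Curves in the space of row vectors and uniqueness of solutions *)

Section RowCalculus.
Context {R : realType}.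

Lemma is_derive_rowP n (x : R -> 'rV[R]_n) (t : R) d :
  is_derive t 1 x d <-> forall i, is_derive t 1 (fun s => x s 0 i) (d 0 i).
Proof.
split=> [[xD <-] i|xD].
  have /derivable_mxP/(_ 0 i) xiD := xD.
  by apply: DeriveDef => //; rewrite derive_mx// mxE.
have xD' : derivable x t 1.
  by apply/derivable_mxP => i j; rewrite ord1; have [] := xD j.
apply: DeriveDef => //; apply/rowP => i.
by rewrite derive_mx// mxE; have [] := xD i.
Qed.

Lemma is_derive_reparam n (x : R -> 'rV[R]_n) (a : R -> R) (t : R) c d :
  is_derive (a t) 1 x d -> is_derive t 1 a c ->
  is_derive t 1 (fun s => x (a s)) (c *: d).
Proof.
move=> /is_derive_rowP xD aD; apply/is_derive_rowP => i; rewrite mxE mulrC.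
exact: (@is_derive1_comp _ (fun s => x s 0 i) a t _ _ (xD i) aD).
Qed.

Lemma is_derive_along n (f : 'rV[R]_n -> R) (x : R -> 'rV[R]_n) (t : R) d :
    differentiable f (x t) -> is_derive t 1 x d ->
  is_derive t 1 (f \o x) (\sum_i partial i f (x t) * d 0 i).
Proof.
move=> fD [xD <-].
have xD' : differentiable x t by exact/derivable1_diffP.
have fxD : differentiable (f \o x) t by exact: differentiable_comp.
apply: DeriveDef; first exact/derivable1_diffP.
rewrite deriveE// diff_comp//= -[X in 'd f _ X]deriveE//.
move: ('D_1 x t) => v.
rewrite [in LHS](row_sum_delta v) linear_sum; apply: eq_bigr => i _.
by rewrite linearZ/= /partial deriveE// mulrC.
Qed.

Definition box n (M : R) (x : 'rV[R]_n) := forall i, `|x 0 i| <= M.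

Lemma bounded_on_box n (h : 'rV[R]_n -> R) (M : R) : continuous h ->
  exists2 B, 0 <= B & forall x, box M x -> `|h x| <= B.
Proof.
move=> hC.
have boxE : [set x : 'rV[R]_n | forall i, x ord0 i \in `[- M, M]] = box M.
  by apply/seteqP; split=> x xM i; have := xM i; rewrite in_itv/= ler_norml.
have boxC : compact (@box n M).
  rewrite -boxE; apply: (@rV_compact _ _ (fun=> `[- M, M]%classic)) => _.
  exact: segment_compact.
have /ex_strict_bound_gt0[B B_gt0 /= hB] : bounded_set (h @` @box n M).
  apply/compact_bounded/continuous_compact => //.
  exact: continuous_subspaceT.
exists B; first exact: ltW.
by move=> x xM; apply/ltW/hB; exists x.
Qed.

(** The partial derivatives are bounded on the compact box, which contains the
    segment between x and y. *)
Lemma lipschitz_on_box n (f : 'rV[R]_n -> R) (M : R) : Ck 1 f ->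
  exists2 L, 0 <= L & forall x y, box M x -> box M y ->
    `|f x - f y| <= L * \sum_i `|x 0 i - y 0 i|.
Proof.
move=> [fD dfC].
have /choice[B BP] : forall i, exists B,
    0 <= B /\ forall x, box M x -> `|partial i f x| <= B.
  by move=> i; have [B B0 BM] := bounded_on_box M (dfC i); exists B.
have L_ge0 : 0 <= \sum_i B i by apply: sumr_ge0 => i _; have [] := BP i.
exists (\sum_i B i) => // x y xM yM.
pose z (s : R) := y + s *: (x - y).
have zD (s : R) : is_derive s 1 z (x - y).
  apply/is_derive_rowP => i; rewrite /z; under eq_fun do rewrite 2!mxE.
  apply: is_derive_eq (is_deriveD (is_derive_cst (y 0 i) s 1)
    (is_deriveM (is_derive_id s 1) (is_derive_cst ((x - y) 0 i) s 1))) _.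
  by rewrite /GRing.scale/=; ring.
have fzD (s : R) := is_derive_along (fD (z s)) (zD s).
have [c /andP[c0 c1]] := mean_value ler01 fzD.
have z1 : z 1 = x by rewrite /z scale1r addrC subrK.
have z0 : z 0 = y by rewrite /z scale0r addr0.
rewrite /= z1 z0 subr0 mulr1 => ->.
have zM : box M (z c).
  move=> i; have := xM i; have := yM i; rewrite !mxE !ler_norml.
  nra.
apply: le_trans (ler_norm_sum _ _ _) _; rewrite mulr_sumr.
apply: ler_sum => i _; rewrite normrM !mxE ler_wpM2r//.
have [_ /(_ _ zM) /le_trans] := BP i; apply.
by rewrite (bigD1 i)//= lerDl; apply: sumr_ge0 => j _; have [] := BP j.
Qed.

End RowCalculus.

Section Uniqueness.
Context {R : realType}.

Lemma is_derive_fsum (I : finType) (x : I -> R -> R) (dx : I -> R) (t : R) :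
  (forall i, is_derive t 1 (x i) (dx i)) ->
  is_derive t 1 (fun s => \sum_i x i s) (\sum_i dx i).
Proof.
move=> xD; elim: (index_enum I) => [|i r IH].
  under eq_fun do rewrite big_nil; rewrite big_nil; exact: is_derive_cst.
under eq_fun do rewrite big_cons; rewrite big_cons; exact: is_deriveD.
Qed.

(** D s * expR (- C s) is nonincreasing and D s * expR (C s) is nondecreasing
    on [a, b], so a zero of D propagates in both directions. *)
Lemma gronwall_zero (D dD : R -> R) (C a b : R) : a <= b ->
    (forall t : R, is_derive t 1 D (dD t)) -> (forall t, 0 <= D t) ->
    (forall t, a <= t <= b -> `|dD t| <= C * D t) ->
  (D a == 0) = (D b == 0).
Proof.
move=> ab DD D_ge0 dDC.
have expD (c t : R) :
    is_derive t 1 (fun s => D s * expR (c * s))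
      ((dD t + c * D t) * expR (c * t)).
  have eD := is_derive1_comp (is_derive_expR (c * t))
    (is_deriveZ c (is_derive_id t (1 : R))).
  apply: is_derive_eq (is_deriveM (DD t) eD) _.
  by rewrite /GRing.scale/=; ring.
apply/eqP/eqP => D0.
  have [t tab] := mean_value ab (expD (- C)).
  rewrite D0 mul0r subr0 => DbE.
  suff : D b * expR (- C * b) <= 0.
    by rewrite pmulr_lle0 ?expR_gt0// => Db; apply/le_anti; rewrite Db D_ge0.
  rewrite DbE mulr_le0_ge0 ?subr_ge0// mulr_le0_ge0 ?expR_ge0//.
  by have := dDC t tab; rewrite ler_norml; lra.
have [t tab] := mean_value ab (expD C).
rewrite D0 mul0r sub0r => DaE.
suff : D a * expR (C * a) <= 0.
  by rewrite pmulr_lle0 ?expR_gt0// => Da; apply/le_anti; rewrite Da D_ge0.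
rewrite -oppr_ge0 DaE mulr_ge0 ?subr_ge0// mulr_ge0 ?expR_ge0//.
by have := dDC t tab; rewrite ler_norml; lra.
Qed.

(** Gronwall's argument for the sum of the squares of the differences.  The
    coordinates are indexed by an arbitrary finite type, so that the lemma
    applies to a single curve and to a pair of curves in different spaces. *)
Lemma ode_unique (I : finType) (x y dx dy : I -> R -> R) (t0 : R) :
    (forall i (t : R), is_derive t 1 (x i) (dx i t)) ->
    (forall i (t : R), is_derive t 1 (y i) (dy i t)) ->
    (forall a b, exists L, forall i t, a <= t <= b ->
       `|dx i t - dy i t| <= L * \sum_j `|x j t - y j t|) ->
    (forall i, x i t0 = y i t0) ->
  forall i t, x i t = y i t.
Proof.
move=> xD yD xyL xy0 i t.
pose d j s := x j s - y j s.
pose D s := \sum_j d j s ^+ 2.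
pose dD s := \sum_j 2 * d j s * (dx j s - dy j s).
have DD (s : R) : is_derive s 1 D (dD s).
  apply: is_derive_fsum => j.
  have dE := is_deriveB (xD j s) (yD j s).
  apply: is_derive_eq (is_deriveM dE dE) _.
  by rewrite /GRing.scale/= !fctE /d; ring.
have D_ge0 s : 0 <= D s by apply: sumr_ge0 => j _; rewrite sqr_ge0.
have D_t0 : D t0 = 0.
  by rewrite /D big1// => j _; rewrite /d xy0 subrr expr0n.
have growth a b : exists C, forall s, a <= s <= b -> `|dD s| <= C * D s.
  have [L LP] := xyL a b.
  exists (4 * `|L| * #|I|%:R) => s sab.
  (* |d_j| |d_k| <= d_j^2 + d_k^2 replaces the Cauchy-Schwarz inequality, at
     the cost of a larger constant. *)
  have dD_le : `|dD s| <=
      \sum_j \sum_k 2 * `|L| * (d j s ^+ 2 + d k s ^+ 2).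
    apply: le_trans (ler_norm_sum _ _ _) _; apply: ler_sum => j _.
    rewrite normrM normrM ger0_norm//.
    have : `|dx j s - dy j s| <= `|L| * \sum_k `|d k s|.
      apply: le_trans (LP j s sab) _; rewrite ler_wpM2r ?ler_norm//.
      exact: sumr_ge0.
    move=> /(ler_wpM2l (_ : 0 <= 2 * `|d j s|))/le_trans; apply.
      by rewrite mulr_ge0.
    rewrite !mulr_sumr; apply: ler_sum => k _.
    rewrite -(real_normK (num_real (d j s))) -(real_normK (num_real (d k s))).
    have := sqr_ge0 (`|d j s| - `|d k s|).
    have := normr_ge0 L; nra.
  apply: le_trans dD_le _; rewrite le_eqVlt; apply/orP; left; apply/eqP.
  under eq_bigr do rewrite -mulr_sumr big_split/= sumr_const -/(D s).
  rewrite -mulr_sumr big_split/= sumr_const sumrMnl -/(D s).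
  have -> : #|(xpredT : pred I)| = #|I| by exact: eq_card.
  by rewrite -!(mulr_natr (D s)); move: (#|I|%:R : R) => N; ring.
have Dt : D t = 0.
  have [t0t|/ltW tt0] := leP t0 t.
    have [C CP] := growth t0 t.
    by apply/eqP; rewrite -(gronwall_zero t0t DD D_ge0 CP) D_t0.
  have [C CP] := growth t t0.
  by apply/eqP; rewrite (gronwall_zero tt0 DD D_ge0 CP) D_t0.
have /eqP := Dt; rewrite psumr_eq0; last by move=> j _; exact: sqr_ge0.
by move=> /allP/(_ i (mem_index_enum i)); rewrite sqrf_eq0 subr_eq0 => /eqP.
Qed.

End Uniqueness.

(** * Gradient ascent curves and the two-player flow *)

Section HiddenGame.
Context {R : realType}.

Lemma curve_in_box n (x dx : R -> 'rV[R]_n) (a b : R) :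
    (forall t : R, is_derive t 1 x (dx t)) ->
  exists M, forall t, a <= t <= b -> box M (x t).
Proof.
move=> xD.
have /choice[B BP] : forall i, exists B,
    0 <= B /\ forall t, a <= t <= b -> `|x t 0 i| <= B.
  move=> i.
  have xiD (t : R) : is_derive t 1 (fun s => x s 0 i) (dx t 0 i).
    by have /is_derive_rowP := xD t.
  have xiC := derive_continuous xiD.
  have /ex_strict_bound_gt0[B B_gt0 /= xB] :
      bounded_set ((fun s => x s 0 i) @` `[a, b]).
    apply/compact_bounded/continuous_compact; last exact: segment_compact.
    exact: continuous_subspaceT.
  exists B; split=> [|t tab]; first exact: ltW.
  by apply/ltW/xB; exists t => //=; rewrite in_itv.
exists (\sum_i B i) => t tab i.
have [_ /(_ t tab)/le_trans] := BP i; apply.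
by rewrite (bigD1 i)//= lerDl; apply: sumr_ge0 => j _; have [] := BP j.
Qed.

Lemma grad_lipschitz_on_box n (f : 'rV[R]_n -> R) (M : R) : Ck 2 f ->
  exists2 L, 0 <= L & forall i x y, box M x -> box M y ->
    `|partial i f x - partial i f y| <= L * \sum_j `|x 0 j - y 0 j|.
Proof.
move=> [_ dfC1].
have /choice[L LP] : forall i, exists L, 0 <= L /\ forall x y,
    box M x -> box M y ->
    `|partial i f x - partial i f y| <= L * \sum_j `|x 0 j - y 0 j|.
  by move=> i; have [L L0 LM] := lipschitz_on_box M (dfC1 i); exists L.
exists (\sum_i L i) => [|i x y xM yM].
  by apply: sumr_ge0 => i _; have [] := LP i.
have [_ /(_ _ _ xM yM)/le_trans] := LP i; apply.
rewrite ler_wpM2r ?sumr_ge0// (bigD1 i)//= lerDl.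
by apply: sumr_ge0 => j _; have [] := LP j.
Qed.

Lemma grad_bounded_on_box n (f : 'rV[R]_n -> R) (M : R) : Ck 1 f ->
  exists2 B, 0 <= B & forall i x, box M x -> `|partial i f x| <= B.
Proof.
move=> [_ dfC].
have /choice[B BP] : forall i, exists B,
    0 <= B /\ forall x, box M x -> `|partial i f x| <= B.
  by move=> i; have [B B0 BM] := bounded_on_box M (dfC i); exists B.
exists (\sum_i B i) => [|i x xM].
  by apply: sumr_ge0 => i _; have [] := BP i.
have [_ /(_ _ xM)/le_trans] := BP i; apply.
by rewrite (bigD1 i)//= lerDl; apply: sumr_ge0 => j _; have [] := BP j.
Qed.

(** The constant curve at a stationary point solves the same equation. *)
Lemma ascent_from_stationary n (f : 'rV[R]_n -> R) x0 gamma (s t : R) :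
    smooth f -> gradient_ascent f x0 gamma ->
  stationary f (gamma s) -> gamma t = gamma s.
Proof.
move=> fS [_ gammaD] fs0.
have fs0i i : partial i f (gamma s) = 0.
  by have /rowP/(_ i) := fs0; rewrite !mxE.
apply/rowP => i.
have gammaiD j (u : R) :
    is_derive u 1 (fun w => gamma w 0 j) (partial j f (gamma u)).
  by have /is_derive_rowP/(_ j) := gammaD u; rewrite mxE.
apply: (@ode_unique _ _ (fun j u => gamma u 0 j) (fun j _ => gamma s 0 j)
  (fun j u => partial j f (gamma u)) (fun _ _ => 0) s) => // a b.
have [M MP] := curve_in_box (Num.min a s) (Num.max b s) gammaD.
have [L _ LP] := grad_lipschitz_on_box M (fS 2%N).
exists L => j u /andP[au ub]; have := LP j (gamma u) (gamma s).
rewrite fs0i; apply; apply: MP; first by rewrite ge_min au le_max ub.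
by rewrite ge_min lexx orbT le_max lexx orbT.
Qed.

(** The ascent curve is reparametrised by a shift of time so that f takes the
    value p at time 0; then the initial point is reached at some time u0. *)
Lemma ascent_profile n (f : 'rV[R]_n -> R) x0 (p : R) : smooth f ->
    ~ stationary f x0 -> ascent_values f x0 p ->
  exists (X : R -> 'rV[R]_n) (u0 c : R),
    [/\ X u0 = x0, forall u : R, is_derive u 1 X (grad f (X u)) &
     let k u := f (X u) - p in
     [/\ continuous k, {mono k : x y / x <= y}, k 0 = 0,
         is_derive (0 : R) 1 k c & 0 < c]].
Proof.
move=> fS x0_ns [gamma gammaP [s _ fsE]].
have [gamma0 gammaD] := gammaP.
pose X (u : R) := gamma (u + s).
have XD (u : R) : is_derive u 1 X (grad f (X u)).
  have := @is_derive_reparam _ _ gamma (shift s) u _ _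
    (gammaD (u + s)) (is_derive_shift u 1 s).
  by rewrite scale1r.
pose k (u : R) := f (X u) - p.
pose dk (u : R) := \sum_i partial i f (X u) * partial i f (X u).
have kD (u : R) : is_derive u 1 k (dk u).
  have [fD _] := fS 1%N.
  apply: is_derive_eq
    (is_deriveB (is_derive_along (fD (X u)) (XD u)) (is_derive_cst p u 1)) _.
  by rewrite subr0; apply: eq_bigr => i _; rewrite mxE.
have dk_ge0 u : 0 <= dk u by apply: sumr_ge0 => i _; rewrite -expr2 sqr_ge0.
have dk_gt0 u : 0 < dk u.
  rewrite lt_neqAle dk_ge0 andbT eq_sym; apply/negP => /eqP dk0.
  apply: x0_ns; rewrite -gamma0.
  suff Xu : stationary f (X u).
    by rewrite (ascent_from_stationary 0 fS gammaP Xu).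
  apply/rowP => i; rewrite !mxE; move/eqP: dk0.
  rewrite psumr_eq0 => [/allP/(_ i (mem_index_enum i))|j _]; last first.
    by rewrite -expr2 sqr_ge0.
  by rewrite mulf_eq0 orbb => /eqP.
exists X, (- s), (dk 0); split => //; first by rewrite /X addNr.
split => //.
- exact: (derive_continuous kD).
- exact: derive_gt0_increasing dk_gt0.
- by rewrite /X add0r [f _]fsE subrr.
Qed.

(** Stated for one of the two components of the vector field; the other one
    is the same with the roles of f and g exchanged. *)
Lemma gda_field_lipschitz n m (f : 'rV[R]_n -> R) (g : 'rV[R]_m -> R)
    (c q M : R) : smooth f -> smooth g ->
  exists2 L, 0 <= L & forall i x x' y y', box M x -> box M x' ->
    box M y -> box M y' ->
    `|c * (g y - q) * partial i f x - c * (g y' - q) * partial i f x'| <=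
      L * (\sum_j `|x 0 j - x' 0 j| + \sum_j `|y 0 j - y' 0 j|).
Proof.
move=> fS gS.
have [Lf Lf0 LfP] := grad_lipschitz_on_box M (fS 2%N).
have [Bf Bf0 BfP] := grad_bounded_on_box M (fS 1%N).
have [Lg Lg0 LgP] := lipschitz_on_box M (gS 1%N).
have [Bg Bg0 BgP] := bounded_on_box M (gS 0%N).
pose L := `|c| * (Lg * Bf + (Bg + `|q|) * Lf).
have L0 : 0 <= L by rewrite mulr_ge0// addr_ge0// mulr_ge0// addr_ge0.
exists L => // i x x' y y' xM x'M yM y'M.
set Sx := \sum_j `|x 0 j - _|; set Sy := \sum_j `|y 0 j - _|.
have Sx0 : 0 <= Sx by exact: sumr_ge0.
have Sy0 : 0 <= Sy by exact: sumr_ge0.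
have -> : c * (g y - q) * partial i f x - c * (g y' - q) * partial i f x' =
    c * ((g y - g y') * partial i f x +
         (g y' - q) * (partial i f x - partial i f x')) by ring.
rewrite normrM /L -mulrA ler_wpM2l//.
apply: le_trans (ler_normD _ _) _; rewrite !normrM.
have gyq : `|g y' - q| <= Bg + `|q|.
  by apply: le_trans (ler_normB _ _) _; rewrite lerD2r BgP.
have h1 : `|g y - g y'| * `|partial i f x| <= Lg * Sy * Bf.
  by apply: ler_pM => //; [exact: LgP|exact: BfP].
have h2 : `|g y' - q| * `|partial i f x - partial i f x'| <=
    (Bg + `|q|) * (Lf * Sx).
  by apply: ler_pM => //; exact: LfP.
apply: le_trans (lerD h1 h2) _.
have e1 : 0 <= Lg * Bf * Sx by rewrite !mulr_ge0.
have e2 : 0 <= (Bg + `|q|) * Lf * Sy by rewrite !mulr_ge0// addr_ge0.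
by rewrite -subr_ge0; apply: le_trans (addr_ge0 e1 e2) _; rewrite le_eqVlt;
  apply/orP; left; apply/eqP; ring.
Qed.

(** The two components are treated as one system with coordinates indexed by
    'I_n + 'I_m. *)
Lemma gda_orbit_unique n m (f : 'rV[R]_n -> R) (g : 'rV[R]_m -> R) U
    theta0 phi0 theta phi theta' phi' : smooth f -> smooth g ->
    gda_orbit f g U theta0 phi0 theta phi ->
    gda_orbit f g U theta0 phi0 theta' phi' ->
  theta = theta' /\ phi = phi'.
Proof.
move=> fS gS [th0 ph0 thD phD] [th'0 ph'0 th'D ph'D].
set v := game_v U in thD phD th'D ph'D.
set q := game_q U in thD phD th'D ph'D.
set p := game_p U in thD phD th'D ph'D.
pose x (th : R -> 'rV[R]_n) (ph : R -> 'rV[R]_m) (i : 'I_n + 'I_m) t :=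
  match i with inl i => th t 0 i | inr j => ph t 0 j end.
pose dx (th : R -> 'rV[R]_n) (ph : R -> 'rV[R]_m) (i : 'I_n + 'I_m) t :=
  match i with
  | inl i => - v * (g (ph t) - q) * partial i f (th t)
  | inr j => v * (f (th t) - p) * partial j g (ph t)
  end.
have xD th ph :
    (forall t : R,
       is_derive t 1 th (- (v * (g (ph t) - q)) *: grad f (th t))) ->
    (forall t : R, is_derive t 1 ph ((v * (f (th t) - p)) *: grad g (ph t))) ->
    forall i (t : R), is_derive t 1 (x th ph i) (dx th ph i t).
  move=> thD' phD' [i|j] t.
    by have /is_derive_rowP/(_ i) := thD' t; rewrite !mxE -mulNr.
  by have /is_derive_rowP/(_ j) := phD' t; rewrite !mxE.
have xE : forall i t, x theta phi i t = x theta' phi' i t.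
  apply: (ode_unique (t0 := 0) (xD _ _ thD phD) (xD _ _ th'D ph'D)); last first.
    by move=> [i|j]; rewrite /x ?th0 ?th'0 ?ph0 ?ph'0.
  move=> a b.
  have [M1 M1P] := curve_in_box a b thD.
  have [M2 M2P] := curve_in_box a b phD.
  have [M3 M3P] := curve_in_box a b th'D.
  have [M4 M4P] := curve_in_box a b ph'D.
  pose M := Num.max (Num.max M1 M2) (Num.max M3 M4).
  have [L1 L10 L1P] := gda_field_lipschitz (- v) q M fS gS.
  have [L2 L20 L2P] := gda_field_lipschitz v p M gS fS.
  have MP k (N : R) (z : 'rV[R]_k) : N <= M -> box N z -> box M z.
    by move=> NM zN i; exact: le_trans (zN i) NM.
  exists (L1 + L2) => i t tab.
  have h1 : box M (theta t) by apply: MP (M1P t tab); rewrite !le_max lexx.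
  have h2 : box M (phi t) by apply: MP (M2P t tab); rewrite !le_max lexx !orbT.
  have h3 : box M (theta' t).
    by apply: MP (M3P t tab); rewrite !le_max lexx !orbT.
  have h4 : box M (phi' t) by apply: MP (M4P t tab); rewrite !le_max lexx !orbT.
  rewrite big_sumType/= mulrDl.
  set S1 := \sum_j _; set S2 := \sum_j _.
  have S12 : 0 <= S1 + S2 by rewrite addr_ge0// sumr_ge0.
  case: i => i /=.
    by apply: le_trans (L1P i _ _ _ _ h1 h3 h2 h4) _; rewrite lerDl mulr_ge0.
  apply: le_trans (L2P i _ _ _ _ h2 h4 h1 h3) _.
  by rewrite [X in L2 * X]addrC lerDr mulr_ge0.
split; apply/funext => t; apply/rowP => i.
  exact: (xE (inl i) t).
exact: (xE (inr i) t).
Qed.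

End HiddenGame.

Theorem theorem3 (R : realType) (n m : nat)
    (f : 'rV[R]_n -> R) (g : 'rV[R]_m -> R) (U : 'M[R]_2)
    (theta0 : 'rV[R]_n) (phi0 : 'rV[R]_m)
    (f01 : forall x, 0 <= f x <= 1) (g01 : forall y, 0 <= g y <= 1)
    (smooth_f : smooth f) (smooth_g : smooth g)
    (v_neq0 : game_v U != 0)
    (q01 : 0 < game_q U < 1) (p01 : 0 < game_p U < 1)
    (safe0 : safe f g U theta0 phi0) :
  (exists theta phi, gda_orbit f g U theta0 phi0 theta phi) /\
  (forall theta phi, gda_orbit f g U theta0 phi0 theta phi ->
     periodic_orbit theta phi).
Proof.
have [theta0_ns phi0_ns f_p g_q] := safe0.
have [X [a0 [cf [X0 XD [kC kM k0 kD cf_gt0]]]]] :=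
  ascent_profile smooth_f theta0_ns f_p.
have [Y [b0 [cg [Y0 YD [lC lM l0 lD cg_gt0]]]]] :=
  ascent_profile smooth_g phi0_ns g_q.
have [a [b [aE bE aD bD [T [T_gt0 aT bT]]]]] :=
  planar_center a0 b0 v_neq0 kC kM k0 kD cf_gt0 lC lM l0 lD cg_gt0.
have orbit : gda_orbit f g U theta0 phi0 (fun t => X (a t)) (fun t => Y (b t)).
  split; rewrite ?aE ?bE// => t.
    exact: is_derive_reparam (XD (a t)) (aD t).
  exact: is_derive_reparam (YD (b t)) (bD t).
split; first by exists (fun t => X (a t)), (fun t => Y (b t)).
move=> theta phi orbit'.
have [<- <-] := gda_orbit_unique smooth_f smooth_g orbit orbit'.
by exists T; split=> // t; rewrite /= ?aT ?bT.
Qed.
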